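(* Let $\Lambda,\mu,R>0$, $\rho=\Lambda/\mu$, and $C_1,C_2\ge0$ with $\max\{C_1,C_2\}>0$. In the unobservable infinite-server queue, the unique equilibrium strategy (joining probability) for customers, denoted by $q_e$, is given as follows: (a) if $R-(C_1\rho+C_2\rho^2)\ge0$, then $q_e=1$; (b) if $R-(C_1\rho+C_2\rho^2)<0$, then $q_e=\dfrac{-C_1+\sqrt{C_1^2+4RC_2}}{2C_2\rho}$ (read as its limit $\dfrac{R}{C_1\rho}$ when $C_2=0$).
   Context: Unobservable infinite-server queue: customers arrive in a Poisson process of rate $\Lambda$, sojourn times are i.i.d. with mean $1/\mu$, $\rho=\Lambda/\mu$, and customers do not observe the number of customers present. If every customer joins independently with probability $q\in[0,1]$, the system is an $M/G/\infty$ queue with arrival rate $\Lambda q$ and expected number in system $\mathbb{E}(L)=\rho q$. The utility of a joining customer is then $U(q)=R-(C_1\mathbb{E}(L)+C_2\mathbb{E}(L)^2)=R-(C_1\rho q+C_2(\rho q)^2)$, and a balking customer has utility $0$. An equilibrium strategy is a symmetric Nash equilibrium: a $q\in[0,1]$ that is a best response when all others use $q$, i.e. either $q=1$ and $U(1)\ge0$, or $q=0$ and $U(0)\le0$, or $0<q<1$ and $U(q)=0$. *)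

(* Defs.v *)
From mathcomp Require Import all_boot all_order all_algebra.
From mathcomp Require Import reals.
Set Implicit Arguments.
Unset Strict Implicit.
Unset Printing Implicit Defensive.
Import Order.TTheory GRing.Theory Num.Theory.
Local Open Scope ring_scope.

Definition load {K : realType} (Lambda mu : K) : K := Lambda / mu.

(* Mean stationary number of customers in the M/G/infinity queue with arrival
   rate Lambda * q and mean sojourn time 1 / mu; the sojourn-time distribution
   enters only through its mean. *)
Definition expected_number {K : realType} (Lambda mu q : K) : K :=
  load Lambda mu * q.

(* Expected utility of a joining customer when everybody else joins with
   probability q. *)
Definition utility {K : realType} (Lambda mu R C1 C2 q : K) : K :=
  R - (C1 * expected_number Lambda mu q
       + C2 * expected_number Lambda mu q ^+ 2).

(* Expected payoff of a tagged customer who joins with probability p while the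
   others join with probability q; balking yields 0. *)
Definition payoff {K : realType} (Lambda mu R C1 C2 p q : K) : K :=
  p * utility Lambda mu R C1 C2 q + (1 - p) * 0.

Definition best_response {K : realType} (Lambda mu R C1 C2 p q : K) : Prop :=
  0 <= p <= 1 /\
  forall p', 0 <= p' <= 1 ->
    payoff Lambda mu R C1 C2 p' q <= payoff Lambda mu R C1 C2 p q.

Definition equilibrium {K : realType} (Lambda mu R C1 C2 q : K) : Prop :=
  best_response Lambda mu R C1 C2 q q.

Lemma equilibriumP (K : realType) (Lambda mu R C1 C2 q : K) :
  equilibrium Lambda mu R C1 C2 q <->
  [\/ q = 1 /\ 0 <= utility Lambda mu R C1 C2 1,
      q = 0 /\ utility Lambda mu R C1 C2 0 <= 0
    | 0 < q < 1 /\ utility Lambda mu R C1 C2 q = 0].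
Proof.
rewrite /equilibrium /best_response /payoff.
split=> [[/andP[q0 q1] H]|].
  have := H 1; have := H 0; rewrite !lexx ler01 !mulr0 !addr0 mul0r mul1r.
  move=> /(_ isT) H0 /(_ isT) H1.
  have [qE|qn0] := eqVneq q 0.
    by apply: Or32; split=> //; rewrite qE mul0r in H1.
  have [qE|qn1] := eqVneq q 1.
    by apply: Or31; split=> //; rewrite qE mul1r in H0.
  have qgt0 : 0 < q by rewrite lt_def qn0.
  have qlt1 : q < 1 by rewrite lt_neqAle qn1.
  apply: Or33; split; first exact/andP.
  apply: le_anti; apply/andP; split; last by rewrite pmulr_rge0 in H0.
  by move: H1; rewrite -subr_le0 -{1}[utility _ _ _ _ _ _]mul1r -mulrBl
    pmulr_rle0 // subr_gt0.
case=> [[-> U]|[-> U]|[/andP[q0 q1] U]]; split.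
- by rewrite ler01 lexx.
- by move=> p /andP[_ p1]; rewrite !mulr0 !addr0 ler_wpM2r.
- by rewrite ler01 lexx.
- by move=> p /andP[p0 _]; rewrite !mulr0 !addr0 mul0r mulr_ge0_le0.
- by rewrite !ltW.
- by move=> p _; rewrite U !mulr0.
Qed.

(* For C2 = 0 the quotient is replaced by its limit as C2 tends to 0. *)
Definition interior_probability {K : realType} (Lambda mu R C1 C2 : K) : K :=
  let rho := load Lambda mu in
  if C2 == 0 then R / (C1 * rho)
  else (- C1 + Num.sqrt (C1 ^+ 2 + 4 * R * C2)) / (2 * C2 * rho).

(* Main.v *)
Require Import Defs.
From mathcomp Require Import all_boot all_order all_algebra.
From mathcomp Require Import reals.
From mathcomp Require Import ring lra.
Import Order.TTheory GRing.Theory Num.Theory.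
Local Open Scope ring_scope.

(** Joining makes the system more crowded, so the utility U(q) of a joining
customer is strictly decreasing in the joining probability q of the others
([utility_decreasing]).  In an equilibrium q > 0 joining cannot be worse than
balking, and in an equilibrium q < 1 it cannot be better; two equilibria
q < q' would therefore give U(q) <= 0 <= U(q') < U(q), which is absurd
([equilibrium_unique]).

Existence follows from the sign of U(1).  If U(1) >= 0, then q = 1 is an
equilibrium.  If U(1) < 0, then the positive root of the polynomial U
([utility_interior], [interior_probability_gt0]) lies below 1 because U is
decreasing, and it leaves customers indifferent between joining and balking. *)

Section UnobservableQueue.
Variables (K : realType) (Lambda mu R C1 C2 : K).
Hypotheses (Lambda_gt0 : 0 < Lambda) (mu_gt0 : 0 < mu).
Hypotheses (C1_ge0 : 0 <= C1) (C2_ge0 : 0 <= C2) (C_gt0 : 0 < Num.max C1 C2).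

Local Notation rho := (load Lambda mu).
Local Notation U := (utility Lambda mu R C1 C2).

Lemma load_gt0 : 0 < rho.
Proof. exact: divr_gt0. Qed.

Lemma utility1 : U 1 = R - (C1 * rho + C2 * rho ^+ 2).
Proof. by rewrite /utility /expected_number mulr1. Qed.

(** The difference U(p) - U(q) factors as (y - x) (C1 + C2 (x + y)), where x < y
are the mean numbers in system; both factors are positive as soon as one of the
two cost coefficients is. *)
Lemma utility_decreasing p q : 0 <= p -> p < q -> U q < U p.
Proof.
move=> p_ge0 lt_pq; rewrite -subr_gt0 /utility /expected_number.
set x := rho * p; set y := rho * q.
have -> : R - (C1 * x + C2 * x ^+ 2) - (R - (C1 * y + C2 * y ^+ 2))
          = (y - x) * (C1 + C2 * (x + y)) by ring.
have x_ge0 : 0 <= x by rewrite mulr_ge0 // ltW // load_gt0.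
have lt_xy : x < y by rewrite ltr_pM2l // load_gt0.
have xy_gt0 : 0 < x + y by lra.
rewrite mulr_gt0 ?subr_gt0 //.
move: C_gt0; rewrite lt_max => /orP[C1_gt0|C2_gt0].
- by rewrite ltr_pwDl // mulr_ge0 // ltW.
- by rewrite ltr_wpDl // mulr_gt0.
Qed.

Lemma equilibrium_itv q : equilibrium Lambda mu R C1 C2 q -> 0 <= q <= 1.
Proof. by case. Qed.

Lemma equilibrium_utility_le0 q :
  equilibrium Lambda mu R C1 C2 q -> q < 1 -> U q <= 0.
Proof.
by case/equilibriumP=> [[-> _]|[-> //]|[_ ->] //]; rewrite ltxx.
Qed.

Lemma equilibrium_utility_ge0 q :
  equilibrium Lambda mu R C1 C2 q -> 0 < q -> 0 <= U q.
Proof.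
by case/equilibriumP=> [[-> //]|[-> _]|[_ ->] //]; rewrite ltxx.
Qed.

(** Crowding is self-limiting: the larger of two equilibria would offer a
strictly smaller utility than the smaller one, where joining is already not
worthwhile. *)
Lemma equilibrium_unique q q' :
  equilibrium Lambda mu R C1 C2 q -> equilibrium Lambda mu R C1 C2 q' -> q = q'.
Proof.
wlog lt_qq' : q q' / q < q' => [hwlog|] eq_q eq_q'.
  by case: (ltgtP q q') => // [lt|gt]; [|symmetry]; apply: hwlog.
have /andP[q_ge0 _] := equilibrium_itv q eq_q.
have /andP[_ q'_le1] := equilibrium_itv q' eq_q'.
have := equilibrium_utility_le0 q eq_q (lt_le_trans lt_qq' q'_le1).
have := equilibrium_utility_ge0 q' eq_q' (le_lt_trans q_ge0 lt_qq').
have := utility_decreasing q q' q_ge0 lt_qq'.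
lra.
Qed.

Hypothesis R_gt0 : 0 < R.

Local Notation q_int := (interior_probability Lambda mu R C1 C2).

Lemma C1_gt0_of_C2_eq0 : C2 = 0 -> 0 < C1.
Proof. by move=> C2E; move: C_gt0; rewrite C2E lt_max ltxx orbF. Qed.

(** The mean number in system at the interior probability is a root of
C2 x ^ 2 + C1 x - R. *)
Lemma utility_interior : U q_int = 0.
Proof.
have rho_neq0 : rho != 0 by rewrite gt_eqF // load_gt0.
rewrite /utility /expected_number /interior_probability.
have [C2E|C2_neq0] := eqVneq C2 0.
  have C1_neq0 : C1 != 0 by rewrite gt_eqF // C1_gt0_of_C2_eq0.
  by rewrite C2E; field; rewrite rho_neq0.
set s := Num.sqrt _.
have sE : s ^+ 2 = C1 ^+ 2 + 4 * R * C2.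
  by rewrite sqr_sqrtr // addr_ge0 ?sqr_ge0 // !mulr_ge0 // ltW.
have -> : rho * ((- C1 + s) / (2 * C2 * rho)) = (s - C1) / (2 * C2).
  by field; rewrite rho_neq0 C2_neq0.
have -> : R - (C1 * ((s - C1) / (2 * C2)) + C2 * ((s - C1) / (2 * C2)) ^+ 2)
          = (C1 ^+ 2 + 4 * R * C2 - s ^+ 2) / (4 * C2).
  by field.
by rewrite sE subrr mul0r.
Qed.

Lemma interior_probability_gt0 : 0 < q_int.
Proof.
have rho_gt0 := load_gt0.
rewrite /interior_probability; have [C2E|C2_neq0] := eqVneq C2 0.
  by rewrite divr_gt0 // mulr_gt0 // C1_gt0_of_C2_eq0.
have C2_gt0 : 0 < C2 by rewrite lt_def C2_neq0.
have RC2_gt0 : 0 < 4 * R * C2 by rewrite !mulr_gt0.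
rewrite divr_gt0 //; last by rewrite mulr_gt0 // mulr_gt0.
rewrite addrC subr_gt0 -[ltLHS](ger0_norm C1_ge0) -sqrtr_sqr.
by rewrite ltr_sqrt ?ltrDl // ltr_wpDl ?sqr_ge0.
Qed.

Lemma interior_probability_lt1 : U 1 < 0 -> q_int < 1.
Proof.
move=> U1_lt0; rewrite ltNge le_eqVlt; apply/negP=> /orP[/eqP qE|lt1q].
  by move: U1_lt0; rewrite qE utility_interior ltxx.
by have := utility_decreasing 1 q_int ler01 lt1q; rewrite utility_interior; lra.
Qed.

End UnobservableQueue.

Theorem theorem5 (K : realType) (Lambda mu R C1 C2 : K)
    (Lambda_gt0 : 0 < Lambda) (mu_gt0 : 0 < mu) (R_gt0 : 0 < R)
    (C1_ge0 : 0 <= C1) (C2_ge0 : 0 <= C2) (C_gt0 : 0 < Num.max C1 C2) :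
  let rho := load Lambda mu in
  exists q_e : K,
    [/\ unique (equilibrium Lambda mu R C1 C2) q_e,
        0 <= R - (C1 * rho + C2 * rho ^+ 2) -> q_e = 1
      & R - (C1 * rho + C2 * rho ^+ 2) < 0 ->
        q_e = interior_probability Lambda mu R C1 C2].
Proof.
move=> rho; rewrite -utility1.
have [U1_ge0|U1_lt0] := leP 0 (utility Lambda mu R C1 C2 1).
- exists 1; split=> //.
  have eq1 : equilibrium Lambda mu R C1 C2 1 by apply/equilibriumP; apply: Or31.
  by split=> // q eq_q; apply: equilibrium_unique eq1 eq_q.
- exists (interior_probability Lambda mu R C1 C2); split=> //.
  have eq_int : equilibrium Lambda mu R C1 C2
                  (interior_probability Lambda mu R C1 C2).
    apply/equilibriumP; apply: Or33; split; last exact: utility_interior.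
    by rewrite interior_probability_gt0 // interior_probability_lt1.
  by split=> // q eq_q; apply: equilibrium_unique eq_int eq_q.
Qed.
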